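(* Let $I\subseteq\mathbb{R}$ be an interval with interior $I^\circ$, let $F:I^\circ\to\mathbb{R}$ be a twice differentiable mapping on $I^\circ$, and let $a,b\in I^\circ$ with $a<b$. If $|F''|$ is $(h-s)_2$-convex on $[a,b]$, then $$\left|\frac{F'(a)+F'(b)}{2}-\frac{1}{b-a}\int_a^b F'(x)\,dx\right|\le\frac{b-a}{2}\bigl(|F''(a)|+|F''(b)|\bigr)\int_0^1|1-2t|\,h^s(t)\,dt$$ and $$\frac{b-a}{2}\bigl(|F''(a)|+|F''(b)|\bigr)\int_0^1|1-2t|\,h^s(t)\,dt\le\frac{b-a}{2}\bigl(|F''(a)|+|F''(b)|\bigr)\left(K+2\int_0^1 t\,h^s(t)\,dt\right),$$ where $K=\int_0^1 h^s(t)\,dt$.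
   Context: Let $J\subseteq\mathbb{R}$ with $[0,1]\subseteq J$, let $h:J\to\mathbb{R}$ be a nonnegative function with $h\not\equiv 0$ and $h\in L_1[0,1]$, and let $s\in(0,1]$. Write $h^s(t)=(h(t))^s$. A function $\varphi$ is $(h-s)_2$-convex on $[a,b]$ if it is nonnegative and for all $u,v\in[a,b]$ and $t\in[0,1]$, $$\varphi(tu+(1-t)v)\le h^s(t)\varphi(u)+h^s(1-t)\varphi(v).$$ *)

(* Defs.v *)
From HB Require Import structures.
From mathcomp Require Import all_boot all_order all_algebra.
From mathcomp Require Import all_classical all_reals all_analysis.
Set Implicit Arguments.
Unset Strict Implicit.
Unset Printing Implicit Defensive.
Import Order.TTheory GRing.Theory Num.Theory.
Import numFieldNormedType.Exports.
Local Open Scope ring_scope.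
Local Open Scope classical_set_scope.

(* Functions given on a subset of the line (h on J, F on the interior of I) are
   total functions R -> R below; only their values on that subset matter.
   The completed Lebesgue measure is used because measurability for
   lebesgue_measure is Borel measurability, whereas L_1[0,1] consists of
   Lebesgue-measurable functions. *)
Notation leb R := (@completed_lebesgue_measure R).

Definition L1_01 (R : realType) (h : R -> R) : Prop :=
  (leb R).-integrable `[0, 1] (fun t : R => (h t)%:E).

Definition hs2_convex (R : realType) (h : R -> R) (s : R) (phi : R -> R)
    (a b : R) : Prop :=
  (forall u : R, u \in `[a, b]%R -> 0 <= phi u) /\
  (forall u v t : R,
     u \in `[a, b]%R -> v \in `[a, b]%R -> t \in `[0, 1]%R ->
     phi (t * u + (1 - t) * v) <=
       (h t `^ s) * phi u + (h (1 - t) `^ s) * phi v).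

Definition twice_differentiable_on (R : realType) (A : set R) (F : R -> R) :
    Prop :=
  forall x, A x -> derivable F x 1 /\ derivable (derive1 F) x 1.

(* Main.v *)
Require Import Defs.
From HB Require Import structures.
From mathcomp Require Import all_boot all_order all_algebra.
From mathcomp Require Import all_classical all_reals all_analysis.
From mathcomp Require Import ring lra measurable_realfun.
Set Implicit Arguments.
Unset Strict Implicit.
Unset Printing Implicit Defensive.
Import Order.TTheory GRing.Theory Num.Theory.
Import numFieldNormedType.Exports.
Local Open Scope ring_scope.
Local Open Scope classical_set_scope.

(** Put [X t = t a + (1 - t) b] and
      [Phi t = (b - a) / 2 * (1 - 2 t) * F' (X t) - F (X t)].
    Then [Phi 1 - Phi 0] is [- (b - a)] times the trapezoid error of [F'] on
    [[a, b]], and [Phi' t = - (b - a)^2 / 2 * (1 - 2 t) * F'' (X t)].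
    Convexity of [|F''|], applied to the endpoints, gives
      [|Phi' t| <= (b - a)^2 / 2 * |1 - 2 t|
                   * (h^s(t) |F''(a)| + h^s(1 - t) |F''(b)|)],
    and the right-hand side has the announced integral because [t -> 1 - t]
    preserves Lebesgue measure.  The second inequality is
    [|1 - 2 t| <= 1 + 2 t].

    The delicate point is to pass from this pointwise bound to
    [|Phi 1 - Phi 0| <= \int |Phi'|]: the derivative [F''] is only known to
    exist, and the majorant need not be bounded.  Convexity helps once more.
    At [t = 1/2] it says that [|F''|] at a midpoint is controlled by its values
    at the two ends; since [|F''|] is finite everywhere and measurable, this
    forces it to be bounded on every compact subset of the open interval
    ([midpoint_bounded]).  On such a subset the fundamental theorem of calculus
    follows from dominated convergence of difference quotients
    ([bounded_derive1_FTC]), and continuity of [Phi] takes care of the endpoints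
    ([mean_value_integral_le]). *)

(** * The fundamental theorem of calculus for bounded derivatives *)

Definition clamp (R : realType) (c d x : R) : R := Num.max c (Num.min x d).

Definition diff_quotient (R : realType) (f : R -> R) (n : nat) (x : R) : R :=
  n.+1%:R * (f (x + n.+1%:R^-1) - f x).

Section difference_quotients.
Context {R : realType}.
Implicit Types (f : R -> R) (c d x y M : R).

Lemma clamp_itv c d x : c <= d -> c <= clamp c d x <= d.
Proof. by move=> cd; rewrite /clamp le_max lexx ge_max cd ge_min lexx orbT. Qed.

Lemma clamp_id c d x : c <= x <= d -> clamp c d x = x.
Proof. by case/andP=> cx xd; rewrite /clamp min_l// max_r. Qed.

Lemma clamp_le c d x y : x <= y -> clamp c d x <= clamp c d y.
Proof.
move=> xy; rewrite /clamp ge_max le_max lexx/= le_max; apply/orP; right.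
by rewrite le_min !ge_min xy lexx/= orbT.
Qed.

Lemma clampD_le c d x e : 0 <= e -> clamp c d (x + e) - clamp c d x <= e.
Proof. by move=> e0; rewrite /clamp !maxEle !minEle; do !case: ifPn; lra. Qed.

Lemma clamp_continuous c d : continuous (clamp c d).
Proof.
have cm : continuous (fun x : R => Num.min x d).
  move=> x; apply: (@continuous_min R R (fun x => x) (fun=> d)).
    exact: cvg_id.
  exact: cvg_cst.
move=> x; apply: (@continuous_max R R (fun=> c) (fun x => Num.min x d)).
  exact: cvg_cst.
exact: cm.
Qed.

Lemma clamp_comp_continuous f c d : c <= d ->
  (forall x, c <= x <= d -> derivable f x 1) -> continuous (f \o clamp c d).
Proof.
move=> cd df x; apply: continuous_comp; first exact: clamp_continuous.
apply/differentiable_continuous/derivable1_diffP/df; exact: clamp_itv.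
Qed.

Lemma diff_quotient_continuous f n :
  continuous f -> continuous (diff_quotient f n).
Proof.
move=> cf x; apply: cvgM; first exact: cvg_cst.
apply: cvgB; last exact: cf.
have cs : {for x, continuous (fun y : R => y + n.+1%:R^-1)}.
  by apply: cvgD; [exact: cvg_id|exact: cvg_cst].
exact: (continuous_comp cs (cf _)).
Qed.

Lemma is_derive_diff_quotient f n x df dfn : is_derive x 1 f df ->
  is_derive (x + n.+1%:R^-1) 1 f dfn ->
  is_derive x 1 (diff_quotient f n) (n.+1%:R * (dfn - df)).
Proof.
move=> Df Dfn.
have Ds : is_derive x 1 (fun y : R => y + n.+1%:R^-1) 1.
  rewrite -[X in is_derive _ _ _ X](addr0 1).
  exact: (is_deriveD (is_derive_id x 1) (is_derive_cst _ x 1)).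
have Dfs := @is_derive1_comp R f (+%R^~ n.+1%:R^-1) x _ _ Dfn Ds.
rewrite mulr1 in Dfs.
exact: (is_deriveZ n.+1%:R (is_deriveB Dfs Df)).
Qed.

Lemma cvg_diff_quotient f x : derivable f x 1 ->
  diff_quotient f n x @[n --> \oo] --> f^`() x.
Proof.
move=> df; rewrite derive1E.
have /cvgr_dnbhsP/(_ (fun n => n.+1%:R^-1)) := df.
have inv0 : (forall n, n.+1%:R^-1 != 0 :> R) /\
    n.+1%:R^-1 @[n --> \oo] --> (0 : R).
  by split; [move=> n; rewrite invr_eq0 pnatr_eq0|exact: cvg_harmonic].
move/(_ inv0); apply: cvg_trans.
apply: near_eq_cvg; near=> n.
by rewrite /diff_quotient /= invrK /GRing.scale/= mulr1 [x + _]addrC.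
Unshelve. all: by end_near. Qed.

Lemma cvg_diff_quotient_clamp f c d x : c < x < d -> derivable f x 1 ->
  diff_quotient (f \o clamp c d) n x @[n --> \oo] --> f^`() x.
Proof.
move=> /andP[cx xd] df; apply: cvg_trans (cvg_diff_quotient df).
apply: near_eq_cvg; near=> n.
have n0 : 0 < n.+1%:R^-1 :> R by rewrite invr_gt0.
have nd : n.+1%:R^-1 < d - x.
  near: n; have dx : 0 < d - x by rewrite subr_gt0.
  exact: (near_infty_natSinv_lt (PosNum dx)).
rewrite /diff_quotient /=; move: n0 nd; set e := _^-1 => e0 ed.
rewrite !clamp_id//; apply/andP; split; lra.
Unshelve. all: by end_near. Qed.

(** The derivative is the pointwise limit of difference quotients; clamping the
    argument makes them continuous on the whole line. *)
Lemma measurable_derive1 f c d : c <= d ->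
  (forall x, c <= x <= d -> derivable f x 1) ->
  measurable_fun (`]c, d[%classic : set (measurableTypeR R)) (f^`() : R -> R).
Proof.
move=> cd df.
apply: (measurable_fun_cvg (h := diff_quotient (f \o clamp c d))) => [n|x /=].
  apply: measurable_funTS; apply: continuous_measurable_fun.
  exact/diff_quotient_continuous/clamp_comp_continuous.
rewrite in_itv/= => cxd; apply: cvg_diff_quotient_clamp => //.
by apply: df; case/andP: cxd => /ltW -> /ltW ->.
Qed.

(** The clamped argument moves by at most the step, so the mean value theorem
    transfers the bound on the derivative. *)
Lemma diff_quotient_clamp_le f c d M n x : c <= d ->
  (forall y, c <= y <= d -> derivable f y 1) ->
  (forall y, c <= y <= d -> `|f^`() y| <= M) ->
  `|diff_quotient (f \o clamp c d) n x| <= M.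
Proof.
move=> cd df fM.
have n0 : 0 < n.+1%:R :> R by [].
have nV0 : 0 < n.+1%:R^-1 :> R by rewrite invr_gt0.
rewrite /diff_quotient normrM gtr0_norm// mulrC -ler_pdivlMr//=.
set u := clamp c d x; set v := clamp c d _.
have uv : u <= v by apply: clamp_le; rewrite lerDl ltW.
have [/andP[cu ud] /andP[cv vd]] : c <= u <= d /\ c <= v <= d.
  by split; exact: clamp_itv.
have [|||z zuv ->] := @MVT_segment R f (f^`()) u v => //.
- move=> z; rewrite in_itv/= => /andP[uz zv].
  by rewrite derive1E; apply/derivableP/df; lra.
- apply: derivable_within_continuous => z; rewrite in_itv/= => /andP[uz zv].
  by apply: df; lra.
move: zuv; rewrite in_itv/= => /andP[uz zv].
rewrite normrM; apply: ler_pM => //; first by apply: fM; lra.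
by rewrite ger0_norm ?subr_ge0//; apply: clampD_le; exact: ltW.
Qed.

(** A bounded derivative integrates back to the function: the difference
    quotients are bounded by the same constant, so dominated convergence
    applies, and their integrals are computed from an antiderivative of the
    clamped function. *)
Lemma bounded_derive1_FTC f c d M : c < d ->
  (forall x, c <= x <= d -> derivable f x 1) ->
  (forall x, c <= x <= d -> `|f^`() x| <= M) ->
  lebesgue_measure.-integrable `]c, d[ (EFin \o f^`()) /\
  \int[lebesgue_measure]_(x in `]c, d[) derive1 f x = f d - f c.
Proof.
move=> cd df fM.
pose g := f \o clamp c d.
have cg : continuous g by exact: clamp_comp_continuous (ltW cd) df.
(* The base point c - 1 leaves room to differentiate P at c. *)
pose P (x : R) : R := \int[lebesgue_measure]_(t in `[c - 1, x]) g t.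
have dP x : c - 1 < x -> derivable P x 1 /\ P^`() x = g x.
  move=> cx; apply: (@continuous_FTC1_closed R g (c - 1) x (x + 1)) => //.
  - by rewrite ltrDl.
  - apply: continuous_compact_integrable; first exact: segment_compact.
    exact: continuous_subspaceT.
  - exact: cg.
have dPg x : c - 1 < x -> is_derive x 1 P (g x).
  by move=> /dP[dPx PE]; apply: DeriveDef dPx _; rewrite -derive1E PE.
have cq n : continuous (diff_quotient g n) by exact: diff_quotient_continuous.
have iq n : (\int[lebesgue_measure]_(x in `]c, d[) (diff_quotient g n x)%:E =
    (diff_quotient P n d - diff_quotient P n c)%:E)%E.
  have dQ x : c - 1 < x ->
      is_derive x 1 (diff_quotient P n) (diff_quotient g n x).
    move=> cx; apply: is_derive_diff_quotient; apply: dPg => //.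
    by rewrite ltr_wpDr.
  rewrite -(@integral_itv_bndoo R c d _ true false); last first.
    apply/measurable_EFinP/measurable_funTS; apply: continuous_measurable_fun.
    exact: cq.
  apply: (@continuous_FTC2 R (diff_quotient g n) (diff_quotient P n) c d cd).
  - exact: continuous_subspaceT.
  - have cQ x : c - 1 < x -> {for x, continuous (diff_quotient P n)}.
      by move=> /dQ[dQx _]; apply/differentiable_continuous/derivable1_diffP.
    split.
    + move=> x; rewrite in_itv/= => cxd; have cx : c - 1 < x by lra.
      by have [] := dQ x cx.
    + by apply: cvg_at_right_filter; apply: cQ; lra.
    + by apply: cvg_at_left_filter; apply: cQ; lra.
  - move=> x; rewrite in_itv/= => cxd; have cx : c - 1 < x by lra.
    by rewrite derive1E; have [] := dQ x cx.
have icst : (@lebesgue_measure R).-integrable `]c, d[ (EFin \o cst M).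
  have : (@lebesgue_measure R).-integrable `[c, d] (EFin \o cst M).
    apply: (@continuous_compact_integrable R (cst M)).
      exact: segment_compact.
    by apply: continuous_subspaceT => x; exact: cvg_cst.
  by apply: integrableS => //; exact: subset_itv_oo_cc.
have [] := @dominated_convergence _ _ _ (@lebesgue_measure R) `]c, d[ _
  (fun n => EFin \o diff_quotient g n) (EFin \o f^`()) (cst M%:E).
- exact: measurable_itv.
- move=> n; apply/measurable_EFinP/measurable_funTS.
  exact: continuous_measurable_fun.
- by apply/measurable_EFinP; exact: (measurable_derive1 (ltW cd) df).
- apply/aeW => x /=; rewrite in_itv/= => cxd.
  apply: cvg_EFin; first by near=> n.
  apply: cvg_diff_quotient_clamp => //.
  by apply: df; case/andP: cxd => /ltW -> /ltW ->.
- exact: icst.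
- apply/aeW => x n _ /=; rewrite lee_fin.
  exact: (diff_quotient_clamp_le n x (ltW cd) df fM).
move=> ifd _ cvgI; split => //.
have cvgP : (diff_quotient P n d - diff_quotient P n c)%:E @[n --> \oo] -->
    (f d - f c)%:E.
  apply: cvg_EFin; first by near=> n.
  have gE x : c <= x <= d -> g x = f x by move=> cxd; rewrite /g/= clamp_id.
  rewrite -(gE d) ?(ltW cd) ?lexx// -(gE c) ?(ltW cd) ?lexx//.
  have [cc1 dc1] : c - 1 < c /\ c - 1 < d by split; lra.
  have [dPc <-] := dP _ cc1; have [dPd <-] := dP _ dc1.
  by apply: cvgB; exact: cvg_diff_quotient.
rewrite /Rintegral; suff -> : (\int[lebesgue_measure]_(x in `]c, d[)
    (derive1 f x)%:E = (f d - f c)%:E)%E by [].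
apply: (cvg_unique _ cvgI); first exact: ereal_hausdorff.
by apply: cvg_trans cvgP; apply: near_eq_cvg; near=> n; rewrite /= iq.
Unshelve. all: by end_near. Qed.

End difference_quotients.

(** * Reflections preserve completed Lebesgue measure *)

Section reflection.
Context {R : realType}.
Implicit Types (A : set R) (c : R).
Local Open Scope ereal_scope.

Notation mu := (@lebesgue_measure R).
Notation mu_star := (@wlength R idfun)^*%mu.

Lemma reflect_continuous c : continuous (fun x : R => (c - x)%R).
Proof. by move=> x; apply: cvgB; [exact: cvg_cst|exact: cvg_id]. Qed.

Lemma measurable_reflect c :
  measurable_fun setT
    ((fun x => (c - x)%R) : measurableTypeR R -> measurableTypeR R).
Proof. by apply: continuous_measurable_fun; exact: reflect_continuous. Qed.

Lemma lebesgue_measure_reflect c A : measurable (A : set (measurableTypeR R)) ->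
  mu ((fun x => (c - x)%R) @^-1` A) = mu A.
Proof.
move=> mA; apply/esym.
pose nu : {measure set (measurableTypeR R) -> \bar R} :=
  measure_function_pushforward__canonical__measure_function_Measure mu
    (measurable_reflect c).
apply: (@lebesgue_measure_unique R nu) => // _ [[a b] _ <-].
rewrite /nu /= /pushforward lebesgue_measure_itv/=.
rewrite (_ : _ @^-1` _ = `[(c - b)%R, (c - a)%R[%classic); last first.
  by apply/seteqP; split => x /=; rewrite !in_itv/= => /andP[? ?];
    apply/andP; split; lra.
rewrite lebesgue_measure_itv/= !lte_fin.
rewrite ltrD2l ltrN2.
by case: ifP => // _; rewrite -!EFinD; congr (_%:E); lra.
Qed.

(** Outer measure is the infimum over open supersets, on which
    [lebesgue_measure_reflect] applies. *)
Lemma outer_lebesgue_measure_reflect c A :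
  mu_star ((fun x => (c - x)%R) @^-1` A) = mu_star A.
Proof.
have le_refl B : mu_star ((fun x => (c - x)%R) @^-1` B) <= mu_star B.
  apply/lee_addgt0Pr => e e0.
  have [U [oU BU /(le_trans _)]] := @outer_measure_open_le R B e e0.
  apply; rewrite -(@lebesgue_measure_reflect c).
    by apply: le_outer_measure => x; exact: BU.
  exact: open_measurable.
apply/eqP; rewrite eq_le le_refl/=.
apply: le_trans (le_refl _); apply: le_outer_measure => x Ax /=.
by rewrite opprB addrC subrK.
Qed.

(** The measurable sets of the completed measure are those satisfying
    Caratheodory's criterion, which is expressed by the outer measure alone. *)
Lemma measurable_reflect_completed c :
  measurable_fun setT ((fun x => (c - x)%R) :
    caratheodory_type mu_star -> caratheodory_type mu_star).
Proof.
move=> _ A mA; rewrite setTI.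
suff : caratheodory_measurable mu_star ((fun x => (c - x)%R) @^-1` A) by [].
have {}mA : caratheodory_measurable mu_star A by [].
move=> X; rewrite -[in LHS](outer_lebesgue_measure_reflect c) mA.
rewrite -[in RHS](outer_lebesgue_measure_reflect c).
rewrite -[in X in _ = _ + X](outer_lebesgue_measure_reflect c).
have AE : (fun x => (c - x)%R) @^-1` ((fun x => (c - x)%R) @^-1` A) = A.
  by apply/funext => x; rewrite /preimage/= opprB addrC subrK.
by rewrite -[in LHS]AE.
Qed.

End reflection.

(** * Integrals for the completed measure *)

Section completed_integral.
Context {R : realType}.
Implicit Types (D : set R) (f : R -> \bar R) (c : R).
Local Open Scope ereal_scope.

Notation mu := (@lebesgue_measure R).
Notation mu_star := (@wlength R idfun)^*%mu.

Lemma measurable_completed D : measurable (D : set (measurableTypeR R)) ->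
  measurable (D : set (caratheodory_type mu_star)).
Proof. exact: sub_caratheodory. Qed.

Lemma measurable_fun_completed d (T : measurableType d) D (f : R -> T) :
  measurable (D : set (measurableTypeR R)) ->
  measurable_fun (D : set (measurableTypeR R)) f ->
  measurable_fun (D : set (caratheodory_type mu_star)) f.
Proof. by move=> mD mf _ B mB; apply: measurable_completed; exact: mf. Qed.

Lemma ge0_integral_completed D f : measurable (D : set (measurableTypeR R)) ->
  measurable_fun (D : set (measurableTypeR R)) f ->
  (forall x, D x -> 0 <= f x) ->
  \int[leb R]_(x in D) f x = \int[mu]_(x in D) f x.
Proof.
move=> mD mf f0.
(* Lebesgue measure is the image of its completion under the identity. *)
have mid : measurable_fun setT
    (id : caratheodory_type mu_star -> measurableTypeR R).
  by move=> _ B mB; rewrite setTI; exact: measurable_completed.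
have := @ge0_integral_pushforward _ _ _ _ R _ mid (leb R) D f mD mf.
rewrite preimage_id => <-; last by move=> x; rewrite inE; exact: f0.
by apply: eq_measure_integral => A mA _.
Qed.

Lemma integrable_completed D f : measurable (D : set (measurableTypeR R)) ->
  mu.-integrable D f -> (leb R).-integrable D f.
Proof.
move=> mD /integrableP[mf foo]; apply/integrableP; split.
  exact: measurable_fun_completed.
rewrite ge0_integral_completed//; exact: measurableT_comp.
Qed.

Lemma integral_completed D f : measurable (D : set (measurableTypeR R)) ->
  measurable_fun (D : set (measurableTypeR R)) f ->
  \int[leb R]_(x in D) f x = \int[mu]_(x in D) f x.
Proof.
move=> mD mf; rewrite [LHS]integralE [RHS]integralE.
rewrite !ge0_integral_completed//.
- exact: measurable_funeneg.
- exact: measurable_funepos.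
Qed.

Lemma ge0_integral_reflect_completed c D f :
  measurable (D : set (caratheodory_type mu_star)) ->
  measurable_fun (D : set (caratheodory_type mu_star)) f ->
  (forall x, D x -> 0 <= f x) ->
  \int[leb R]_(x in (fun x => (c - x)%R) @^-1` D) f (c - x)%R =
  \int[leb R]_(x in D) f x.
Proof.
move=> mD mf f0.
have mr := measurable_reflect_completed c.
have := @ge0_integral_pushforward _ _ _ _ R _ mr (leb R) D f mD mf.
move=> <-; last by move=> x; rewrite inE; exact: f0.
apply: eq_measure_integral => A mA _; exact: outer_lebesgue_measure_reflect.
Qed.

Lemma measurable_fun_reflect_completed c D f :
  measurable (D : set (caratheodory_type mu_star)) ->
  measurable_fun (D : set (caratheodory_type mu_star)) f ->
  measurable_fun
    ((fun x => (c - x)%R) @^-1` D : set (caratheodory_type mu_star))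
    (fun x => f (c - x)%R).
Proof.
move=> mD mf mrD B mB; have mr := measurable_reflect_completed c.
have := mr measurableT _ (mf mD B mB).
by rewrite setTI preimage_setI.
Qed.

Lemma integrable_reflect_completed c D f :
  measurable (D : set (caratheodory_type mu_star)) ->
  (leb R).-integrable D f ->
  (leb R).-integrable ((fun x => (c - x)%R) @^-1` D) (fun x => f (c - x)%R).
Proof.
move=> mD /integrableP[mf foo]; apply/integrableP; split.
  exact: measurable_fun_reflect_completed.
rewrite (ge0_integral_reflect_completed c mD (f := fun x => `|f x|))//.
exact: measurableT_comp.
Qed.

End completed_integral.

(** * Local boundedness of midpoint quasi-convex functions *)

(** Where [phi] exceeds [M] has small measure when [M] is large, so the
    reflection of that set about [x] cannot, together with the set itself, cover
    an interval to the right of [x]: some pair of points symmetric about [x]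
    has values at most [M]. *)
Lemma midpoint_bounded (R : realType) (phi : R -> R) (p q C c d : R) :
  measurable_fun (`]p, q[%classic : set (measurableTypeR R)) phi ->
  0 <= C -> p < c -> d < q ->
  (forall u v, p < u < q -> p < v < q ->
    phi ((u + v) / 2) <= C * (phi u + phi v)) ->
  exists M, forall x, c <= x <= d -> phi x <= M.
Proof.
move=> mphi C0 pc dq phiC.
pose mu : {measure set (measurableTypeR R) -> \bar R} := @lebesgue_measure R.
pose r := Num.min (c - p) (q - d).
have r0 : 0 < r by rewrite lt_min !subr_gt0 pc dq.
have [rc rd] : r <= c - p /\ r <= q - d by rewrite !ge_min !lexx orbT.
pose E (n : nat) : set (measurableTypeR R) := `]p, q[%classic `&`
  phi @^-1` `]n%:R, +oo[%classic.
have mE n : measurable (E n).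
  by apply: mphi; exact: measurable_itv.
have E0 : \bigcap_n E n = set0.
  apply/seteqP; split => // x Ex.
  have [_ /=] := Ex (Num.bound `|phi x|) I.
  rewrite in_itv/= andbT; apply/negP; rewrite -leNgt.
  by rewrite (le_trans (ler_norm _))// ltW// archi_boundP.
have [n En] : exists n, (mu (E n) < (r / 2)%:E)%E.
  have : (mu \o E) n @[n --> \oo] --> mu (\bigcap_n E n).
    apply: nonincreasing_cvg_mu => //.
    - apply: (@le_lt_trans _ _ (mu `]p, q[%classic)).
        by apply: le_measure; rewrite ?inE//; exact: subIsetl.
      rewrite /mu/= lebesgue_measure_itv/=.
      by case: ifP => _; rewrite -?EFinB ltry.
    - by rewrite E0.
    - move=> m n mn; apply/subsetPset => x [px /=].
      rewrite !in_itv/= !andbT => phix; split => //=.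
      rewrite in_itv/= andbT.
      by apply: le_lt_trans phix; rewrite ler_nat.
  rewrite E0 measure0 => /fine_cvgP[Efin /cvgr_lt/(_ (r / 2))].
  rewrite divr_gt0// => /(_ isT) Elt.
  near \oo => n; exists n; rewrite -[ltLHS]fineK ?lte_fin; last by near: n.
  by near: n.
exists (C * (n%:R + n%:R)) => x /andP[cx xd].
have [y [xy yr yE zE]] :
    exists y, [/\ x < y, y < x + r, ~ E n y & ~ E n (2 * x - y)].
  apply/not_existsP => noy.
  have sub : `]x, x + r[%classic `<=` E n `|` (fun y => 2 * x - y) @^-1` (E n).
    move=> y; rewrite /= in_itv/= => /andP[xy yr].
    have := noy y; apply: contra_notP => /not_orP[]. by split.
  have mrE : measurable
      ((fun y => 2 * x - y) @^-1` (E n) : set (measurableTypeR R)).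
    by rewrite -[X in measurable X]setTI; exact: measurable_reflect.
  have : (r%:E <= mu (E n) + mu (E n))%E.
    rewrite -[X in (_ <= _ + X)%E](lebesgue_measure_reflect (2 * x) (mE n)).
    have -> : r%:E = mu `]x, x + r[%classic.
      rewrite /mu/= lebesgue_measure_itv/= lte_fin ltrDl r0 -EFinB.
      by rewrite addrC addKr.
    apply: le_trans (measureU2 mu (mE n) mrE).
    by apply: le_measure; rewrite ?inE//; apply: measurableU => //; exact: mrE.
  apply/negP; rewrite -ltNge [r in r%:E]splitr EFinD; exact: lteD.
have pyq : p < y < q by apply/andP; split; lra.
have pzq : p < 2 * x - y < q by apply/andP; split; lra.
have le_n z : p < z < q -> ~ E n z -> phi z <= n%:R.
  move=> pz; apply: contra_notT; rewrite -ltNge => nz.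
  by split; rewrite /= in_itv/= ?andbT.
have -> : x = (y + (2 * x - y)) / 2 by lra.
apply: le_trans (phiC _ _ pyq pzq) _; apply: ler_wpM2l => //.
by apply: lerD; apply: le_n.
Unshelve. all: by end_near. Qed.

(** * A mean value inequality with an integrable majorant *)

Section mean_value_inequality.
Context {R : realType}.
Implicit Types (f Psi : R -> R) (a b c d : R).

Notation mu_star := (@wlength R idfun)^*%mu.

Let interior_le f Psi a b c d M : a < c -> c < d -> d < b ->
  (forall x, a <= x <= b -> derivable f x 1) ->
  (forall x, c <= x <= d -> `|f^`() x| <= M) ->
  (leb R).-integrable `[a, b] (EFin \o Psi) ->
  (forall x, a <= x <= b -> 0 <= Psi x) ->
  (forall x, a < x < b -> `|f^`() x| <= Psi x) ->
  `|f d - f c| <= \int[leb R]_(x in `[a, b]) Psi x.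
Proof.
move=> ac cd db df fM iPsi Psi0 fPsi.
have dcd x : c <= x <= d -> derivable f x 1.
  by move=> cxd; apply: df; apply/andP; split; lra.
have [ifd fdc] := bounded_derive1_FTC cd dcd fM.
have mcd : measurable (`]c, d[%classic : set (measurableTypeR R)) by [].
have mab : measurable (`[a, b]%classic : set (caratheodory_type mu_star)).
  by apply: measurable_completed; exact: measurable_itv.
have mcd' : measurable (`]c, d[%classic : set (caratheodory_type mu_star)).
  by apply: measurable_completed; exact: measurable_itv.
have sub : `]c, d[%classic `<=` `[a, b]%classic.
  by apply: subset_itv; rewrite bnd_simp ltW.
have iPsicd : (leb R).-integrable `]c, d[ (EFin \o Psi).
  exact: integrableS iPsi.
have ifd' := integrable_completed mcd ifd.
have -> : f d - f c = \int[leb R]_(x in `]c, d[) derive1 f x.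
  rewrite -fdc /Rintegral integral_completed//.
  by case/integrableP : ifd.
apply: le_trans (le_normr_Rintegral mcd' ifd') _.
apply: (@le_trans _ _ (\int[leb R]_(x in `]c, d[) Psi x)).
  apply: le_Rintegral => //; first exact: integrable_norm ifd'.
  by move=> x /=; rewrite in_itv/= => cxd; apply: fPsi; lra.
rewrite /Rintegral fine_le//; [exact: integrable_fin_num..|].
have Psi0' x : `[a, b]%classic x -> (0 <= (Psi x)%:E)%E.
  by rewrite /= in_itv/= lee_fin; exact: Psi0.
have /integrableP[mPsi _] := iPsi.
exact: (ge0_subset_integral (leb R) mcd' mab mPsi Psi0' sub).
Qed.

(** The derivative may be unbounded near the endpoints; there only continuity
    of the function is used. *)
Lemma mean_value_integral_le f Psi a b : a < b ->
  (forall x, a <= x <= b -> derivable f x 1) ->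
  (forall c d, a < c -> d < b ->
    exists M, forall x, c <= x <= d -> `|f^`() x| <= M) ->
  (leb R).-integrable `[a, b] (EFin \o Psi) ->
  (forall x, a <= x <= b -> 0 <= Psi x) ->
  (forall x, a < x < b -> `|f^`() x| <= Psi x) ->
  `|f b - f a| <= \int[leb R]_(x in `[a, b]) Psi x.
Proof.
move=> ab df fM iPsi Psi0 fPsi; apply/ler_addgt0Pr => e e0.
have e2 : 0 < e / 2 by rewrite divr_gt0.
have cf x : a <= x <= b -> {for x, continuous f}.
  by move=> /df ?; exact/differentiable_continuous/derivable1_diffP.
have [c [ac cm fc]] :
    exists c, [/\ a < c, c < (a + b) / 2 & `|f a - f c| < e / 2].
  have /cvgrPdist_lt/(_ _ e2) fa : f x @[x --> a^'+] --> f a.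
    by apply: cvg_at_right_filter; apply: cf; rewrite lexx ltW.
  near a^'+ => c; exists c; split; near: c.
  - exact: nbhs_right_gt.
  - by apply: nbhs_right_lt; lra.
  - exact: fa.
have [d [md db fd]] :
    exists d, [/\ (a + b) / 2 < d, d < b & `|f b - f d| < e / 2].
  have /cvgrPdist_lt/(_ _ e2) fb : f x @[x --> b^'-] --> f b.
    by apply: cvg_at_left_filter; apply: cf; rewrite lexx ltW.
  near b^'- => d; exists d; split; near: d.
  - by apply: nbhs_left_gt; lra.
  - exact: nbhs_left_lt.
  - exact: fb.
have [M Mcd] := fM c d ac db.
have cd : c < d by lra.
have I_ge := interior_le ac cd db df Mcd iPsi Psi0 fPsi.
rewrite (_ : f b - f a = (f b - f d) + (f d - f c) + (f c - f a)); last by lra.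
rewrite (le_trans (ler_normD _ _))// (splitr e).
have := ler_normD (f b - f d) (f d - f c).
rewrite (distrC (f c)); lra.
Unshelve. all: by end_near. Qed.

End mean_value_inequality.

(** * Intervals and integrability *)

Lemma interior_segment (R : realType) (I : set R) (a b : R) : is_interval I ->
  interior I a -> interior I b -> forall x, a <= x <= b -> interior I x.
Proof.
move=> itvI Ia Ib x /andP[]; rewrite le_eqVlt => /predU1P[<-//|ax].
rewrite le_eqVlt => /predU1P[->//|xb].
have [Ia' Ib'] : I a /\ I b by split; exact: nbhs_singleton.
have xab : nbhs x `]a, b[%classic.
  apply: open_nbhs_nbhs; split.
    exact: interval_open.
  by rewrite /= in_itv/= ax.
apply: filterS xab => y /=; rewrite in_itv/= => /andP[ay yb].
by apply: (itvI a b) => //; rewrite (ltW ay) ltW.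
Qed.

(** The power is dominated by [1 + h]. *)
Lemma integrable_powR d (T : measurableType d) (R : realType)
    (mu : {measure set T -> \bar R}) (D : set T) (h : T -> R) (s : R) :
  measurable D -> (mu D < +oo)%E -> 0 <= s -> s <= 1 ->
  (forall x, D x -> 0 <= h x) ->
  mu.-integrable D (EFin \o h) -> mu.-integrable D (fun x => (h x `^ s)%:E).
Proof.
move=> mD muD s0 s1 h0 ih.
have i1 : mu.-integrable D (EFin \o cst (1 : R)).
  apply/integrableP; split; first exact/measurable_EFinP/measurable_cst.
  under eq_integral do rewrite /= normr1.
  by rewrite integral_cst// mul1e.
have i1h := integrableD mD i1 ih.
apply: le_integrable i1h => //.
  apply/measurable_EFinP; apply: (measurableT_comp (measurable_powR s)).
  by case/integrableP : ih => /measurable_EFinP.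
move=> x Dx; rewrite /= lee_fin ger0_norm ?powR_ge0//.
rewrite ger0_norm ?addr_ge0 ?h0//.
have [hx1|hx1] := leP (h x) 1.
  apply: (@le_trans _ _ 1); last by rewrite lerDl h0.
  have -> : 1 = 1 `^ s :> R by rewrite powR1.
  by apply: ge0_ler_powR; rewrite ?nnegrE ?h0.
apply: (@le_trans _ _ (h x)); last by rewrite lerDr.
by rewrite -[leRHS]powRr1 ?h0//; apply: ler_powR => //; exact: ltW.
Qed.

Lemma integrable_continuousM (R : realType) (D : set R) (w H : R -> R) (M : R) :
  measurable (D : set (measurableTypeR R)) ->
  continuous w -> (forall t, D t -> `|w t| <= M) ->
  (leb R).-integrable D (EFin \o H) ->
  (leb R).-integrable D (fun t => (w t * H t)%:E).
Proof.
move=> mD cw wM iH; have mDc := measurable_completed mD.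
have iMH := integrableZl mDc M iH.
apply: (le_integrable mDc _ _ iMH).
  apply/measurable_EFinP; apply: measurable_funM.
    apply: measurable_fun_completed => //.
    by apply: measurable_funTS; exact: continuous_measurable_fun.
  by case/integrableP : iH => /measurable_EFinP.
move=> x Dx; rewrite /= lee_fin !normrM ler_wpM2r//.
by apply: le_trans (wM _ Dx) (ler_norm _).
Qed.


(** * The trapezoid inequality *)

Section trapezoid.
Context {R : realType}.
Variables (F H : R -> R) (a b : R).
Hypothesis ab : a < b.
Hypothesis dF : forall x, a <= x <= b -> derivable F x 1.
Hypothesis dF' : forall x, a <= x <= b -> derivable F^`() x 1.
Hypothesis H_ge0 : forall t : R, t \in `[0, 1]%R -> 0 <= H t.
Hypothesis H_int : (leb R).-integrable `[0, 1] (EFin \o H).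
Let F2 : R -> R := derive1n 2 F.
Hypothesis F2_convex : forall u v t : R,
  u \in `[a, b]%R -> v \in `[a, b]%R -> t \in `[0, 1]%R ->
  `|F2 (t * u + (1 - t) * v)| <= H t * `|F2 u| + H (1 - t) * `|F2 v|.

Let X (t : R) : R := t * a + (1 - t) * b.

Let X_itv t : 0 <= t <= 1 -> a <= X t <= b.
Proof.
move=> /andP[t0 t1]; have ba0 : 0 <= b - a by rewrite subr_ge0 ltW.
have t1' : 0 <= 1 - t by rewrite subr_ge0.
have := mulr_ge0 t0 ba0; have := mulr_ge0 t1' ba0.
by rewrite /X => ? ?; apply/andP; split; lra.
Qed.

Let is_derive_X (t : R) : is_derive t 1 X (a - b).
Proof.
have -> : X = (a - b) \*: (id : R -> R) + cst b.
  by apply/funext => u; rewrite /X !fctE /=; rewrite /GRing.scale/=; lra.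
rewrite -[X in is_derive _ _ _ X]addr0 -[X in X + 0]mulr1.
have D := is_deriveZ (a - b) (is_derive_id t (1 : R)).
exact: (is_deriveD D (is_derive_cst b t 1)).
Qed.

Let is_derive_comp_X (f : R -> R) (t : R) : derivable f (X t) 1 ->
  is_derive t 1 (f \o X) (derive1 f (X t) * (a - b)).
Proof.
move=> df; apply: (@is_derive1_comp R f X t _ _ _ (is_derive_X t)).
by rewrite derive1E; exact: derivableP.
Qed.

(** The weight (b - a) / 2 * (1 - 2 t) is X t minus the midpoint of [a, b]:
   subtracting F \o X cancels the F' terms of the derivative. *)
Let Phi (t : R) : R := (b - a) / 2 * (1 - 2 * t) * derive1 F (X t) - F (X t).

Let dPhi (t : R) : 0 <= t <= 1 ->
  is_derive t 1 Phi (- ((b - a) ^+ 2 / 2) * (1 - 2 * t) * F2 (X t)).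
Proof.
move=> t01; have Xab := X_itv t01.
have D1 := is_derive_comp_X (dF Xab).
have D2 := is_derive_comp_X (dF' Xab).
have Dw : is_derive t 1 (fun t => (b - a) / 2 * (1 - 2 * t)) (a - b).
  have -> : (fun t => (b - a) / 2 * (1 - 2 * t)) =
      (a - b) \*: (id : R -> R) + cst ((b - a) / 2).
    by apply/funext => u; rewrite !fctE /= /GRing.scale/=; field.
  rewrite -[X in is_derive _ _ _ X]addr0 -[X in X + 0]mulr1.
  have D := is_deriveZ (a - b) (is_derive_id t (1 : R)).
  exact: (is_deriveD D (is_derive_cst _ t 1)).
have := is_deriveB (is_deriveM Dw D2) D1.
rewrite /GRing.scale/= => D.
rewrite (_ : - _ * _ * _ = (b - a) / 2 * (1 - 2 * t) * (F2 (X t) * (a - b)) +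
  derive1 F (X t) * (a - b) - derive1 F (X t) * (a - b)); last by lra.
exact: D.
Qed.

Let Phi1E (t : R) : 0 <= t <= 1 ->
  derive1 Phi t = - ((b - a) ^+ 2 / 2) * (1 - 2 * t) * F2 (X t).
Proof. by move=> t01; rewrite derive1E; have [] := dPhi t01. Qed.

(** Convexity at t = 1/2 bounds |F''| at a midpoint by H (1/2) times the sum of
   its values at the ends.  The measurable function used below is the
   derivative of F' \o X, that is F'' \o X up to the factor a - b. *)
Let F2_locally_bounded (c d : R) : 0 < c -> d < 1 ->
  exists M, forall t : R, c <= t <= d -> `|F2 (X t)| <= M.
Proof.
move=> c0 d1.
have D2 (t : R) : 0 <= t <= 1 ->
    is_derive t 1 (F^`() \o X) (F2 (X t) * (a - b)).
  by move=> /X_itv/dF'/is_derive_comp_X.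
pose phi (t : R) : R := `|derive1 (F^`() \o X) t|.
have phiE (t : R) : 0 <= t <= 1 -> phi t = (b - a) * `|F2 (X t)|.
  move=> /D2[_]; rewrite /phi derive1E => ->.
  by rewrite normrM distrC (gtr0_norm (_ : 0 < b - a)) ?subr_gt0// mulrC.
have mphi : measurable_fun (`]0, 1[%classic : set (measurableTypeR R)) phi.
  apply: measurableT_comp => //; apply: measurable_derive1 => // t t01.
  by have [] := D2 t t01.
have half : (2^-1 : R) \in `[0, 1]%R by rewrite in_itv/=; lra.
have [] := @midpoint_bounded R phi 0 1 (H 2^-1) c d mphi _ c0 d1.
- exact: H_ge0.
- move=> u v /andP[u0 u1] /andP[v0 v1].
  rewrite !phiE; try by apply/andP; split; lra.
  rewrite -mulrDr mulrCA ler_pM2l ?subr_gt0//.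
  rewrite (_ : X ((u + v) / 2) = 2^-1 * X u + (1 - 2^-1) * X v); last first.
    by rewrite /X; lra.
  apply: le_trans (F2_convex _ _ half) _.
  + by rewrite in_itv/=; apply: X_itv; rewrite !ltW.
  + by rewrite in_itv/=; apply: X_itv; rewrite !ltW.
  by rewrite (_ : 1 - 2^-1 = 2^-1) ?mulrDr//; lra.
move=> M phiM; exists (M / (b - a)) => t tcd.
rewrite ler_pdivlMr ?subr_gt0// mulrC -phiE; first exact: phiM.
by move/andP : tcd => [? ?]; apply/andP; split; lra.
Qed.

Let w_le1 (t : R) : t \in `[0, 1]%R -> `|1 - 2 * t| <= 1.
Proof. by rewrite in_itv/= ler_norml => /andP[? ?]; apply/andP; split; lra. Qed.

Let W (t : R) : R := `|1 - 2 * t| * H t.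

Let W_int : (leb R).-integrable `[0, 1] (EFin \o W).
Proof.
apply: (@integrable_continuousM _ _ (fun t => `|1 - 2 * t|) H 1) => //.
  move=> t; apply: cvg_norm; apply: cvgB; first exact: cvg_cst.
  by apply: cvgM; [exact: cvg_cst|exact: cvg_id].
by move=> t t01; rewrite normr_id w_le1.
Qed.

Let m01 : measurable
  (`[0, 1]%classic : set (caratheodory_type (@wlength R idfun)^*%mu)).
Proof. by apply: measurable_completed; exact: measurable_itv. Qed.

Let reflect01 : (fun t : R => 1 - t) @^-1` `[0, 1] = `[0, 1]%classic.
Proof.
by apply/seteqP; split => t /=; rewrite !in_itv/= => /andP[? ?];
  apply/andP; split; lra.
Qed.

Let V_int : (leb R).-integrable `[0, 1] (fun t => (W (1 - t))%:E).
Proof.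
by have := integrable_reflect_completed 1 m01 W_int; rewrite reflect01.
Qed.

Let VE : \int[leb R]_(t in `[0, 1]) W (1 - t) = \int[leb R]_(t in `[0, 1]) W t.
Proof.
rewrite /Rintegral; congr fine.
rewrite -[RHS](ge0_integral_reflect_completed 1 m01) ?reflect01//.
  by case/integrableP : W_int.
by move=> t t01; rewrite lee_fin mulr_ge0// H_ge0.
Qed.

Let avg_F' : \int[leb R]_(x in `[a, b]) derive1 F x = F b - F a.
Proof.
have cF' : {within `[a, b], continuous F^`()}.
  by apply: derivable_within_continuous => x; rewrite in_itv/=; exact: dF'.
have cF (x : R) : a <= x <= b -> {for x, continuous F}.
  by move=> /dF ?; exact/differentiable_continuous/derivable1_diffP.
rewrite /Rintegral integral_completed; last 2 first.
- exact: measurable_itv.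
- apply/measurable_EFinP; apply: subspace_continuous_measurable_fun => //.
rewrite (@continuous_FTC2 R F^`() F a b)//; split.
- by move=> x; rewrite in_itv/= => /andP[? ?]; apply: dF; rewrite !ltW.
- by apply: cvg_at_right_filter; apply: cF; rewrite lexx ltW.
- by apply: cvg_at_left_filter; apply: cF; rewrite lexx ltW.
Qed.

(** The function [W] is [t -> |1 - 2 t| H t], and the majorant of [|Phi'|] is
    a combination of [W t] and [W (1 - t)], which have the same integral. *)
Lemma trapezoid_le :
  `|(derive1 F a + derive1 F b) / 2
      - 1 / (b - a) * \int[leb R]_(x in `[a, b]) (derive1 F x)|
    <= (b - a) / 2 * (`|F2 a| + `|F2 b|)
         * \int[leb R]_(t in `[0, 1]) (`|1 - 2 * t| * H t).
Proof.
have ba0 : 0 < b - a by rewrite subr_gt0.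
have ba_neq0 : b - a != 0 by rewrite gt_eqF.
pose k := (b - a) ^+ 2 / 2.
have k0 : 0 <= k by rewrite /k divr_ge0// sqr_ge0.
pose Psi (t : R) : R := k * `|F2 a| * W t + k * `|F2 b| * W (1 - t).
have W0 (t : R) : 0 <= t <= 1 -> 0 <= W t.
  by move=> t01; rewrite mulr_ge0// H_ge0.
have W1 (t : R) : 0 <= t <= 1 -> 0 <= W (1 - t).
  by move=> /andP[? ?]; apply: W0; apply/andP; split; lra.
have i1 : (leb R).-integrable `[0, 1] (EFin \o (fun t => k * `|F2 a| * W t)).
  by have := integrableZl m01 (k * `|F2 a|) W_int.
have i2 : (leb R).-integrable `[0, 1]
    (EFin \o (fun t => k * `|F2 b| * W (1 - t))).
  by have := integrableZl m01 (k * `|F2 b|) V_int.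
have iPsi : (leb R).-integrable `[0, 1] (EFin \o Psi).
  exact: integrableD i1 i2.
have PsiE : \int[leb R]_(t in `[0, 1]) Psi t =
    k * (`|F2 a| + `|F2 b|) * \int[leb R]_(t in `[0, 1]) W t.
  rewrite (RintegralD m01 i1 i2) (RintegralZl _ m01 W_int).
  by rewrite (RintegralZl _ m01 V_int) VE -mulrDl -mulrDr.
have Phi_le (t : R) : 0 <= t <= 1 -> `|derive1 Phi t| <= Psi t.
  move=> t01; rewrite Phi1E// !normrM normrN (ger0_norm k0).
  have VtE : W (1 - t) = `|1 - 2 * t| * H (1 - t).
    by rewrite /W -normrN; congr (`|_| * _); ring.
  have PsiE' (n x y A B : R) :
      k * A * (n * x) + k * B * (n * y) = k * n * (x * A + y * B) by ring.
  rewrite /Psi VtE {1}/W PsiE'; apply: ler_wpM2l; first exact: mulr_ge0.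
  by apply: F2_convex; rewrite in_itv/= ?lexx ?(ltW ab).
have := @mean_value_integral_le R Phi Psi 0 1 ltr01 _ _ iPsi.
rewrite PsiE => main.
have {}main : `|Phi 1 - Phi 0| <=
    k * (`|F2 a| + `|F2 b|) * \int[leb R]_(t in `[0, 1]) W t.
  apply: main.
  - by move=> t /dPhi[].
  - move=> c d c0 d1; have [M F2M] := F2_locally_bounded c0 d1.
    exists (k * M) => t /[dup] tcd /andP[ct td].
    have t01 : 0 <= t <= 1.
      by rewrite (le_trans (ltW c0) ct) (le_trans td (ltW d1)).
    rewrite Phi1E// !normrM normrN (ger0_norm k0) -mulrA ler_wpM2l//.
    rewrite -[leRHS]mul1r ler_pM//; first exact: w_le1.
    exact: F2M.
  - move=> t t01; apply: addr_ge0; apply: mulr_ge0.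
    + exact: mulr_ge0.
    + exact: W0.
    + exact: mulr_ge0.
    + exact: W1.
  - by move=> t /andP[? ?]; apply: Phi_le; rewrite !ltW.
rewrite avg_F'.
have PhiE : Phi 1 - Phi 0 = - (b - a) *
    ((derive1 F a + derive1 F b) / 2 - 1 / (b - a) * (F b - F a)).
  rewrite /Phi /X mul1r mul0r subrr mul0r addr0 subr0 mul1r add0r.
  move: (derive1 F a) (derive1 F b) (F a) (F b) => A B C D.
  by field.
move: main; rewrite PhiE normrM normrN (gtr0_norm ba0) /k.
have -> (A J : R) : (b - a) ^+ 2 / 2 * A * J = (b - a) * ((b - a) / 2 * A * J).
  by ring.
by rewrite ler_pM2l.
Qed.

End trapezoid.

Theorem theorem2p15 (R : realType)
    (J : set R) (J01 : `[0, 1] `<=` J)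
    (h : R -> R) (h_ge0 : forall t, J t -> 0 <= h t)
    (h_neq0 : exists2 t, J t & h t != 0) (h_L1 : L1_01 h)
    (s : R) (s_gt0 : 0 < s) (s_le1 : s <= 1)
    (I : set R) (I_itv : is_interval I)
    (F : R -> R) (F_diff : twice_differentiable_on (interior I) F)
    (a b : R) (Ia : interior I a) (Ib : interior I b) (ab : a < b)
    (F2_convex : hs2_convex h s (fun x => `|derive1n 2 F x|) a b) :
  let K := \int[leb R]_(t in `[0, 1]) (h t `^ s) in
  `|(derive1 F a + derive1 F b) / 2
      - 1 / (b - a) * \int[leb R]_(x in `[a, b]) (derive1 F x)|
    <= (b - a) / 2 * (`|derive1n 2 F a| + `|derive1n 2 F b|)
         * \int[leb R]_(t in `[0, 1]) (`|1 - 2 * t| * h t `^ s)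
  /\
  (b - a) / 2 * (`|derive1n 2 F a| + `|derive1n 2 F b|)
      * \int[leb R]_(t in `[0, 1]) (`|1 - 2 * t| * h t `^ s)
    <= (b - a) / 2 * (`|derive1n 2 F a| + `|derive1n 2 F b|)
         * (K + 2 * \int[leb R]_(t in `[0, 1]) (t * h t `^ s)).
Proof.
have s0 := ltW s_gt0.
have m01 : measurable
    (`[0, 1]%classic : set (caratheodory_type (@wlength R idfun)^*%mu)).
  by apply: measurable_completed; exact: measurable_itv.
have h0 t : `[0, 1]%classic t -> 0 <= h t by move=> /J01/h_ge0.
have H_int : (leb R).-integrable `[0, 1] (EFin \o (fun t => h t `^ s)).
  apply: integrable_powR => //.
  (* Both measures are the same outer measure. *)
  change (lebesgue_measure `[0%R, 1%R]%classic < +oo :> \bar R)%E.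
  by rewrite lebesgue_measure_itv/= lte_fin ltr01 -EFinB ltry.
have dF x : a <= x <= b -> derivable F x 1.
  by move=> axb; have [] := F_diff _ (interior_segment I_itv Ia Ib axb).
have dF' x : a <= x <= b -> derivable F^`() x 1.
  by move=> axb; have [] := F_diff _ (interior_segment I_itv Ia Ib axb).
move=> K; split.
  apply: (trapezoid_le ab dF dF' _ H_int) => [t _|]; first exact: powR_ge0.
  exact: F2_convex.2.
have ci : continuous (fun t : R => t) by move=> t; exact: cvg_id.
have tH_int : (leb R).-integrable `[0, 1] (EFin \o (fun t => t * h t `^ s)).
  apply: (@integrable_continuousM _ _ (fun t => t) _ 1) => //.
  by move=> t; rewrite /= in_itv/= => /andP[t0 t1]; rewrite ger0_norm.
have wH_int : (leb R).-integrable `[0, 1]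
    (EFin \o (fun t => `|1 - 2 * t| * h t `^ s)).
  apply: (@integrable_continuousM _ _ (fun t => `|1 - 2 * t|) _ 1) => //.
    move=> t; apply: cvg_norm; apply: cvgB; first exact: cvg_cst.
    by apply: cvgM; [exact: cvg_cst|exact: ci].
  move=> t; rewrite /= in_itv/= normr_id ler_norml => /andP[? ?].
  by apply/andP; split; lra.
have tH2_int : (leb R).-integrable `[0, 1]
    (EFin \o (fun t => 2 * (t * h t `^ s))).
  by have := integrableZl m01 2 tH_int.
apply: ler_wpM2l.
  by rewrite mulr_ge0// ?addr_ge0// divr_ge0// subr_ge0 ltW.
rewrite /K -(RintegralZl 2 m01 tH_int) -(RintegralD m01 H_int tH2_int).
apply: le_Rintegral => //.
  by have := integrableD m01 H_int tH2_int.
move=> t; rewrite /= in_itv/= => /andP[t0 t1].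
rewrite mulrA -{2}(mul1r (h t `^ s)) -mulrDl.
apply: ler_wpM2r; first exact: powR_ge0.
by rewrite ler_norml; apply/andP; split; lra.
Qed.
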